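(* Let $H$ be an $m\times m$ Hermitian matrix and let $u,v\in\{1,\ldots,m\}$ be distinct. The following hold. 1. $u$ and $v$ are parallel with respect to $H$ if and only if the poles of $\dfrac{\phi_S(H,t)}{\phi(H,t)}$ are simple, where $S=\{u,v\}$. 2. $u$ and $v$ are parallel with respect to $H$ and $\sigma_u(H)=\sigma_v(H)$ if and only if the $H$-modules generated by $\mathbf{e}_u$ and $\mathbf{e}_v$ are equal.
   Context: Write $H=\sum_j\lambda_jE_j$ for the spectral decomposition of $H$, where the $\lambda_j$ are the distinct eigenvalues and $E_j$ is the orthogonal projection onto the eigenspace of $\lambda_j$. $\mathbf{e}_u$ is the standard basis vector indexed by $u$. The indices $u,v$ are called columns of $H$. The eigenvalue support of $u$ is $\sigma_u(H)=\{\lambda_j: E_j\mathbf{e}_u\neq 0\}$. Columns $u$ and $v$ are parallel with respect to $H$ if, for each $j$, $E_j\mathbf{e}_u$ and $E_j\mathbf{e}_v$ are parallel vectors, i.e., one of them is a complex scalar multiple of the other. $\phi(H,t)=\det(tI-H)$, and for $S\subseteq\{1,\ldots,m\}$, $\phi_S(H,t)$ is the determinant of the matrix obtained from $tI-H$ by deleting the rows and columns indexed by $S$ (an empty determinant equals $1$). The $H$-module generated by $\mathbf{e}_u$ is the subspace $\{p(H)\mathbf{e}_u : p\in\mathbb{C}[x]\}$ of $\mathbb{C}^m$. *)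

(* Defs.v *)
From HB Require Import structures.
From mathcomp Require Import all_boot all_order all_algebra.
From mathcomp Require Import complex.
From mathcomp Require Import boolp classical_sets reals.
From mathcomp Require Import ring.

Set Implicit Arguments.
Unset Strict Implicit.
Unset Printing Implicit Defensive.

Import Order.TTheory GRing.Theory Num.Theory.

Local Open Scope ring_scope.
Local Open Scope sesquilinear_scope.

Section Columns.
Variable C : numClosedFieldType.

Definition basis_cV m (u : 'I_m) : 'cV[C]_m := delta_mx u 0.

(* MathComp's [eigenspace] and [proj_ortho] work on row vectors.  The column
   eigenspace { x | H x = a x } consists of the transposes of the rows spanning
   [eigenspace H^T a]; transposing back, this matrix acts on the left of columns
   as the orthogonal projection onto it (see [eigenproj_fixed],
   [eigenproj_idem] and [eigenproj_adj]).  It is 0 when a is not an eigenvalue. *)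
Definition eigenproj m (H : 'M[C]_m) (a : C) : 'M[C]_m :=
  (proj_ortho (eigenspace H^T a))^T.

Definition parallel_vec m (x y : 'cV[C]_m) : Prop :=
  exists c : C, x = c *: y \/ y = c *: x.

Definition parallel_cols m (H : 'M[C]_m) (u v : 'I_m) : Prop :=
  forall a, eigenvalue H a ->
    parallel_vec (eigenproj H a *m basis_cV u) (eigenproj H a *m basis_cV v).

Definition eig_support m (H : 'M[C]_m) (u : 'I_m) : set C :=
  [set a | eigenvalue H a /\ eigenproj H a *m basis_cV u <> 0]%classic.

(* [horner_mx] requires a dimension of the form n.+1, where it agrees with
   this sum (see [poly_mxE]). *)
Definition poly_mx m (p : {poly C}) (H : 'M[C]_m) : 'M[C]_m :=
  \sum_(i < size p) p`_i *: H ^+ i.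

Definition cyclic_module m (H : 'M[C]_m) (u : 'I_m) : set 'cV[C]_m :=
  [set x | exists p : {poly C}, x = poly_mx p H *m basis_cV u]%classic.

Definition char_poly_del m (S : {set 'I_m}) (H : 'M[C]_m) : {poly C} :=
  let keep (i : 'I_#|~: S|) := enum_val i in
  \det (mxsub keep keep (char_poly_mx H)).

Local Notation "x %:F" := (@tofrac _ x).

Definition pole_of_order (f : {fraction {poly C}}) (a : C) (k : nat) : Prop :=
  (0 < k)%N /\ exists p q : {poly C},
    [/\ p.[a] != 0, q.[a] != 0 & f = p%:F / (('X - a%:P) ^+ k * q)%:F].

Definition poles_simple (f : {fraction {poly C}}) : Prop :=
  forall a k, pole_of_order f a k -> k = 1%N.

Lemma poly_mxE m (H : 'M[C]_m.+1) (p : {poly C}) : poly_mx p H = horner_mx H p.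
Proof.
rewrite /poly_mx -[in RHS](coefK p) poly_def rmorph_sum /=.
by apply: eq_bigr => i _; rewrite linearZ rmorphXn /= horner_mx_X.
Qed.

Lemma eigenproj_idem m (H : 'M[C]_m) a :
  eigenproj H a *m eigenproj H a = eigenproj H a.
Proof. by rewrite /eigenproj -trmx_mul proj_ortho_proj. Qed.

Lemma eigenproj_fixed m (H : 'M[C]_m) a (x : 'cV[C]_m) :
  eigenproj H a *m x = x <-> H *m x = a *: x.
Proof.
rewrite /eigenproj; split=> [Ex | Hx].
  have /eigenspaceP : (x^T <= eigenspace H^T a)%MS.
    by rewrite -[in x^T]Ex trmx_mul trmxK proj_ortho_sub.
  by rewrite -trmx_mul -linearZ => /trmx_inj.
apply: trmx_inj; rewrite trmx_mul trmxK proj_ortho_id //.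
by apply/eigenspaceP; rewrite -trmx_mul Hx linearZ.
Qed.

Lemma eigenproj_adj m (H : 'M[C]_m) a :
  (eigenproj H a) ^t* = eigenproj H a.
Proof.
rewrite /eigenproj; set U := eigenspace _ _; set P := proj_ortho U.
have PQ : P *m (1%:M - P) ^t* = 0.
  apply/orthomx1P; apply: submx_trans (_ : U <= _)%MS.
    by rewrite -[P]mul1mx proj_ortho_sub.
  rewrite orthomx_sym; have := proj_ortho_compl_sub U (1%:M : 'M[C]_m).
  by rewrite mul1mx.
have PP : P = P *m P ^t*.
  apply/eqP; rewrite -subr_eq0 -{1}[P]mulmx1 -mulmxBr.
  move: PQ; rewrite linearB /= map_mxB trmx1 map_mx1 => ->; exact/eqP.
have PA : P ^t* = P by rewrite [in LHS]PP trmx_mul map_mxM /= trmxCK -PP.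
by rewrite trmxK -[in RHS]PA map_trmx trmxK.
Qed.

Lemma pole_of_orderE (p q : {poly C}) a k : p != 0 -> q != 0 ->
  pole_of_order (p%:F / q%:F) a k <-> (0 < k)%N /\ (mup a q = mup a p + k)%N.
Proof.
move=> p0 q0.
have XnF n : ('X - a%:P) ^+ n != 0 by rewrite expf_neq0 ?polyXsubC_eq0.
have muX n : mup a (('X - a%:P) ^+ n) = n by rewrite mup_XsubCX eqxx.
have nz (r : {poly C}) : ~~ root r a -> r != 0.
  by apply: contraNneq => ->; rewrite root0.
split=> [[k_gt0 [r [s [ra sa E]]]] | [k_gt0 mupE]]; split=> //.
  have s0 := nz s sa; have r0 := nz r ra.
  move/eqP: E; rewrite eqr_div ?tofrac_eq0 ?mulf_neq0 //.
  rewrite -!tofracM tofrac_eq => /eqP/(congr1 (mup a)).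
  rewrite !mupM ?mulf_neq0 // muX (mupNroot sa) (mupNroot ra) addn0 add0n.
  by move=> ->.
have [i [p' pa Ep]] := multiplicity_XsubC p a.
have [j [q' qa Eq]] := multiplicity_XsubC q a.
rewrite p0 /= in pa; rewrite q0 /= in qa.
have mp : mup a p = i by rewrite Ep mupMr // muX.
have mq : mup a q = j by rewrite Eq mupMr // muX.
exists p', q'; split=> //; apply/eqP.
have q'0 := nz _ qa.
rewrite eqr_div ?tofrac_eq0 ?mulf_neq0 // -!tofracM tofrac_eq.
rewrite Ep Eq -mq mupE mp exprD; apply/eqP.
by rewrite [q' * _]mulrC [_ * q' in RHS]mulrC; ring.
Qed.

End Columns.

(* Main.v *)
Require Import Defs.
From mathcomp Require Import all_boot all_order all_algebra.
From mathcomp Require Import complex.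
From mathcomp Require Import classical_sets reals.
From mathcomp Require Import perm ring.

(** Everything is read off the spectral idempotents [E a := eigenproj H a],
which satisfy [H *m E a = a *: E a], are mutually orthogonal and sum to the
identity over the spectrum of [H] ([eigenproj_eigen], [eigenproj_orth],
[eigenproj_sum1]), thanks to the unitary diagonalization of [H].

Poles.  Let [psi] be the product of the [X - a] over the distinct eigenvalues.
The matrix [B], sum over [a] of [psi / (X - a)] times [E a], is the adjugate of
[X - H] with the common factor [phi / psi] removed: [(X - H) B = psi].
Jacobi's identity for complementary minors ([jacobi_minor2]) then gives
[phi * (B u u * B v v - B u v * B v u) = psi ^+ 2 * phi_S].
At an eigenvalue [a], [psi] has a simple zero and [B] takes the value
[E a] up to a nonzero scalar.  Comparing multiplicities, the order of
the pole of [phi_S / phi] at [a] is at most 2, and at most 1 exactly when the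
2 x 2 minor of [E a] on [u, v] vanishes.  Since [E a] is an orthogonal
projection, that minor is the Gram determinant of its columns [u] and [v], so it
vanishes exactly when they are parallel, by the equality case of Cauchy-Schwarz
([parallel_proj_minor2]).

Modules.  A polynomial [p] acts as [p.[a]] on the range of [E a], and
the values [p.[a]] on the spectrum can be prescribed arbitrarily.  Hence the
module of [u] is contained in that of [v] iff every [E a e_u] is a scalar
multiple of [E a e_v] ([cyclic_module_subset_parallel]).  Both inclusions
together say that the projections are parallel and vanish simultaneously. *)

Set Implicit Arguments.
Unset Strict Implicit.
Unset Printing Implicit Defensive.

Import GRing.Theory Num.Theory.
Local Open Scope ring_scope.
Local Open Scope sesquilinear_scope.

(** * Complementary minors *)

Section Minors.
Variable R : comNzRingType.

Lemma det_mxsub_inj n m (f : 'I_n -> 'I_m) (X : 'M[R]_m) :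
  n = m -> injective f -> \det (mxsub f f X) = \det X.
Proof.
move=> nm; case: m / nm f X => f X f_inj.
have -> : mxsub f f X = row_perm (perm f_inj) (col_perm (perm f_inj) X).
  by apply/matrixP => i j; rewrite !mxE !permE.
rewrite row_permE col_permE !det_mulmx !det_perm odd_permV.
by rewrite mulrCA -expr2 sqrr_sign mulr1.
Qed.

(** Reordering the indices so that the image of [f] comes first turns [X] into a
lower block triangular matrix whose lower right block is the identity. *)
Lemma det_id_cols p m (f : 'I_p -> 'I_m) (X : 'M[R]_m) : injective f ->
    (forall i j, j \notin codom f -> X i j = (i == j)%:R) ->
  \det X = \det (mxsub f f X).
Proof.
move=> f_inj X_id; pose K := [predC codom f].
pose g := [eta @enum_val _ K].
pose h i := match split i with inl a => f a | inr b => g b end.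
have g_out b : g b \notin codom f by exact: (enum_valP b).
have h_inj : injective h.
  move=> i j; rewrite /h -{2}(splitK i) -{2}(splitK j).
  case: (split i) => a; case: (split j) => b //=.
  - by move/f_inj->.
  - by move=> E; have := g_out b; rewrite -E codom_f.
  - by move=> E; have := g_out a; rewrite E codom_f.
  - by move/enum_val_inj->.
have pm : (p + #|K|)%N = m.
  by rewrite -[in LHS](card_ord p) -(card_codom f_inj) cardC card_ord.
rewrite -(det_mxsub_inj X pm h_inj).
have hl a : h (lshift _ a) = f a by rewrite /h (unsplitK (inl a)).
have hr b : h (rshift _ b) = g b by rewrite /h (unsplitK (inr b)).
rewrite -[mxsub h h X]submxK.
have -> : ursubmx (mxsub h h X) = 0.
  apply/matrixP => a b; rewrite !mxE hl hr X_id //.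
  by case: eqP => // E; have := g_out b; rewrite -E codom_f.
have -> : drsubmx (mxsub h h X) = 1%:M.
  apply/matrixP => a b; rewrite !mxE !hr X_id //.
  by rewrite (inj_eq enum_val_inj).
rewrite det_lblock det1 mulr1; congr (\det _).
by apply/matrixP => a b; rewrite !mxE !hl.
Qed.

Definition minor2 m (B : 'M[R]_m) (u v : 'I_m) : R :=
  B u u * B v v - B u v * B v u.

Definition minor_del m (S : {set 'I_m}) (M : 'M[R]_m) : R :=
  let keep (i : 'I_#|~: S|) := enum_val i in \det (mxsub keep keep M).

(** Jacobi's identity for a 2 x 2 minor, with any [B] inverting [M] up to the
scalar [psi] in place of the adjugate: take the determinant of [M *m N], where
[N] has the columns [u] and [v] of [B] and those of the identity elsewhere. The
product is [M] with these two columns replaced by [psi] times basis vectors. *)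
Lemma jacobi_minor2 m (M B : 'M[R]_m) (psi : R) (u v : 'I_m) :
    u != v -> M *m B = psi%:M ->
  \det M * minor2 B u v = psi ^+ 2 * minor_del [set u; v]%SET M.
Proof.
move=> uv MB.
pose inS (j : 'I_m) := j \in [set u; v]%SET.
pose N := \matrix_(i, j) if inS j then B i j else (i == j)%:R.
pose M' := \matrix_(i, j) if inS j then (i == j)%:R else M i j.
pose d := \row_j if inS j then psi else 1.
have MN : M *m N = M' *m diag_mx d.
  apply/matrixP => i j; rewrite mul_mx_diag !mxE /=.
  case: (boolP (inS j)) => jS.
    have := congr1 (fun X : 'M_m => X i j) MB; rewrite !mxE mulr_natl => <-.
    by apply: eq_bigr => k _; rewrite !mxE jS.
  rewrite mulr1 (bigD1 j) //= big1 => [|k kj]; rewrite !mxE (negPf jS).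
    by rewrite eqxx mulr1 addr0.
  by rewrite (negPf kj) mulr0.
have detN : \det N = minor2 B u v.
  pose f := tnth [tuple u; v].
  have f0 : f 0 = u by [].
  have f1 : f 1 = v by [].
  have inSf j : j \notin codom f -> inS j = false.
    rewrite /inS !inE; apply: contraNF => /orP[]/eqP->.
      by rewrite -[u]f0 codom_f.
    by rewrite -[v]f1 codom_f.
  rewrite (@det_id_cols 2 _ f); first last.
  - by move=> i j /inSf jS; rewrite mxE jS.
  - move=> i j; apply: tuple_uniqP => /=; last by rewrite inE uv.
  rewrite (expand_det_row _ 0) !big_ord_recl big_ord0.
  rewrite /cofactor !det_mx11 !mxE /=.
  rewrite /inS !inE !eqxx orbT /=.
  transitivity
    (B u u * ((-1) ^+ 0 * B v v) + (B u v * ((-1) ^+ 1 * B v u) + 0)).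
    by [].
  by rewrite /minor2 expr0 expr1 mul1r addr0 mulN1r mulrN.
have detd : \det (diag_mx d) = psi ^+ 2.
  rewrite det_diag (bigD1 u) //= (bigD1 v) 1?eq_sym //=.
  rewrite big1 => [|j /andP[ju jv]].
    by rewrite !mxE /inS !inE !eqxx orbT mulr1.
  by rewrite mxE /inS !inE (negPf ju) (negPf jv).
have detM' : \det M' = minor_del [set u; v]%SET M.
  rewrite /minor_del; set keep := fun _ => _.
  rewrite (@det_id_cols _ _ keep); first last.
  - move=> i j jS; rewrite mxE; case: ifPn => // jS'; case/negP: jS.
    have jS2 : j \in ~: [set u; v]%SET by rewrite finset.in_setC.
    by rewrite -(enum_rankK_in jS2 jS2); apply: (codom_f keep).
  - exact: enum_val_inj.
  congr (\det _); apply/matrixP => i j; rewrite !mxE.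
  by have := enum_valP j; rewrite finset.in_setC /inS => /negPf->.
by rewrite -detN -detM' -det_mulmx MN det_mulmx detd mulrC.
Qed.

End Minors.

(** * The spectral idempotents of a normal matrix *)

Section Eigenproj.
Variables (C : numClosedFieldType) (m : nat) (H : 'M[C]_m) (a : C).

Lemma eigenproj_id n (X : 'M[C]_(m, n)) :
  H *m X = a *: X -> eigenproj H a *m X = X.
Proof.
move=> HX; apply/matrixP => i j.
have [_ /(_ _)] := eigenproj_fixed H a (X *m delta_mx j 0).
rewrite mulmxA HX -scalemxAl => /(_ erefl)/matrixP/(_ i 0).
by rewrite mulmxA -!colE !mxE.
Qed.

Lemma eigenproj_eigen : H *m eigenproj H a = a *: eigenproj H a.
Proof.
apply/matrixP => i j.
have [+ _] := eigenproj_fixed H a (eigenproj H a *m delta_mx j 0).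
rewrite mulmxA eigenproj_idem => /(_ erefl)/matrixP/(_ i 0).
by rewrite mulmxA scalemxAl -!colE !mxE.
Qed.

End Eigenproj.

Section Spectral.
Variables (C : numClosedFieldType) (m : nat) (H : 'M[C]_m).
Hypothesis H_normal : H \is normalmx.

Local Notation d := (spectral_diag H 0).
Local Notation P := (spectralmx H).
Local Notation E := (eigenproj H).

Definition diag_ind a : 'M[C]_m := diag_mx (\row_i (d i == a)%:R).

(** The right-hand side [F] has its range in the eigenspace and fixes it, so
[E a *m F = F] and [F *m E a = E a]; both being Hermitian, they coincide. *)
Lemma eigenproj_spectral a : E a = invmx P *m diag_ind a *m P.
Proof.
have Pu := spectral_unit H; have HE := orthomx_spectralP H_normal.
set D := diag_ind a; pose F := invmx P *m D *m P.
have HF : H *m F = a *: F.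
  rewrite {1}HE /F -!mulmxA mulKVmx // !mulmxA scalemxAl -(mulmxA (invmx P)).
  congr (_ *m _); rewrite scalemxAr; congr (_ *m _).
  rewrite /D; apply/matrixP => i j; rewrite mul_diag_mx !mxE.
  by have [->|_] := eqVneq (d i) a; rewrite ?mul0rn ?mulr0.
have EF : E a *m F = F by exact: eigenproj_id.
have FE : F *m E a = E a.
  have PE : diag_mx (spectral_diag H) *m (P *m E a) = a *: (P *m E a).
    have /(congr1 (mulmx P)) := HE; rewrite -!mulmxA mulKVmx // => PH.
    by rewrite scalemxAr -eigenproj_eigen !mulmxA PH.
  rewrite /F -!mulmxA; have -> : D *m (P *m E a) = P *m E a.
    move: PE; set X := P *m _ => PE.
    apply/matrixP => i j; rewrite /D mul_diag_mx !mxE.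
    have := congr1 (fun X : 'M_m => X i j) PE; rewrite /= mul_diag_mx.
    rewrite !mxE; have [_ _|da /eqP] := eqVneq (d i) a; first by rewrite mul1r.
    by rewrite -subr_eq0 -mulrBl mulf_eq0 subr_eq0 (negPf da) mul0r => /eqP->.
  by rewrite mulKmx.
have F_adj : F ^t* = F.
  rewrite /F invmx_unitary ?spectral_unitarymx // !trmx_mul !map_mxM.
  rewrite map_trmx trmxK -map_mx_comp (map_mx_id (@conjCK _)).
  rewrite tr_diag_mx map_diag_mx mulmxA; congr (_ *m diag_mx _ *m _).
  by apply/rowP => i; rewrite !mxE rmorph_nat.
by rewrite -eigenproj_adj -FE trmx_mul map_mxM /= eigenproj_adj F_adj EF.
Qed.

Lemma eigenproj_eq0 a : (E a == 0) = (a \notin [seq d i | i : 'I_m]).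
Proof.
have Pu := spectral_unit H.
rewrite eigenproj_spectral.
apply/eqP/idP => [E0|a_out].
  apply/negP => /codomP[i da].
  move: E0 => /(congr1 (fun X => P *m X *m invmx P)) /=.
  rewrite mulmx0 mul0mx -!mulmxA mulmxV // mulmx1 mulKVmx //.
  move=> /matrixP/(_ i i); rewrite !mxE eqxx da eqxx => /eqP.
  by rewrite oner_eq0.
suff -> : diag_ind a = 0 by rewrite mulmx0 mul0mx.
apply/matrixP => i j; rewrite !mxE.
case: eqP => [da|_]; last by rewrite mul0rn.
by rewrite -da codom_f in a_out.
Qed.

Lemma eigenproj_orth a b : a != b -> E a *m E b = 0.
Proof.
move=> ab; have DD : diag_ind a *m diag_ind b = 0.
  rewrite mulmx_diag; apply/matrixP => i j; rewrite !mxE.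
  have [->|_] := eqVneq (d i) a; last by rewrite mul0r mul0rn.
  by rewrite (negPf ab) mulr0 mul0rn.
rewrite !eigenproj_spectral -!mulmxA mulKVmx ?spectral_unit //.
by rewrite (mulmxA (diag_ind a)) DD mul0mx mulmx0.
Qed.

Definition spectrum := undup [seq d i | i : 'I_m].

Lemma eigenproj_sum1 : \sum_(a <- spectrum) E a = 1%:M.
Proof.
under eq_bigr do rewrite eigenproj_spectral.
rewrite -mulmx_suml -mulmx_sumr.
suff -> : \sum_(a <- spectrum) diag_ind a = 1%:M.
  by rewrite mulmx1 mulVmx ?spectral_unit.
apply/matrixP => i j; rewrite summxE !mxE.
rewrite (bigD1_seq (d i)) ?undup_uniq ?mem_undup ?codom_f //=.
rewrite !mxE eqxx big1 ?addr0 // => a; rewrite eq_sym !mxE => /negPf->.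
by rewrite mul0rn.
Qed.

Lemma eigenvalue_spectrum a : eigenvalue H a = (a \in spectrum).
Proof.
apply/eigenvalueP/idP => [[x xH x0]|a_in].
  apply: contraNT x0 => a_out; rewrite -[x]mulmx1 -eigenproj_sum1 mulmx_sumr.
  rewrite big_seq big1 // => b b_in; apply/eqP.
  have /eqP : a *: (x *m E b) = b *: (x *m E b).
    by rewrite scalemxAl -xH -mulmxA eigenproj_eigen scalemxAr.
  rewrite -subr_eq0 -scalerBl scaler_eq0 subr_eq0.
  by case: eqP => //= ab; rewrite ab b_in in a_out.
(* [eigenvalue] asks for a row eigenvector; the rows of [E a] provide one. *)
have EH : E a *m H = a *: E a.
  rewrite -[LHS]mulmx1 -eigenproj_sum1 mulmx_sumr.
  under eq_bigr do rewrite -mulmxA eigenproj_eigen -scalemxAr.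
  rewrite (bigD1_seq a) ?undup_uniq //= big1 => [|b /negPf ba].
    by rewrite addr0 eigenproj_idem.
  by rewrite eigenproj_orth ?scaler0 // eq_sym ba.
have : E a != 0 by rewrite eigenproj_eq0 negbK -mem_undup.
case/rowV0Pn => x /submxP[y ->] x0; exists (y *m E a) => //.
by rewrite -mulmxA EH scalemxAr.
Qed.

Lemma poly_mx_spectral p : poly_mx p H = \sum_(a <- spectrum) p.[a] *: E a.
Proof.
have HE k a : H ^+ k *m E a = a ^+ k *: E a.
  elim: k => [|k IHk]; first by rewrite !expr0 mul1mx scale1r.
  by rewrite exprSr -mulmxA eigenproj_eigen -scalemxAr IHk scalerA -exprS.
rewrite -[LHS]mulmx1 -eigenproj_sum1 mulmx_sumr.
apply: eq_bigr => a _; rewrite /poly_mx mulmx_suml horner_coef scaler_suml.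
by apply: eq_bigr => k _; rewrite -scalemxAl HE scalerA.
Qed.

(** By orthogonality of the idempotents, [e_u = p(H) e_v] can be tested on each
eigenspace separately. *)
Lemma cyclic_module_subP u v :
  (cyclic_module H u `<=` cyclic_module H v)%classic <->
  exists p : {poly C}, forall a,
    a \in spectrum -> E a *m basis_cV C u = p.[a] *: (E a *m basis_cV C v).
Proof.
split=> [uv|[p uv] _ [q ->]].
  have [|p pE] := uv (basis_cV C u).
    exists 1; rewrite poly_mx_spectral.
    under eq_bigr do rewrite hornerC scale1r.
    by rewrite eigenproj_sum1 mul1mx.
  exists p => a a_in; rewrite {1}pE poly_mx_spectral mulmxA mulmx_sumr.
  rewrite (bigD1_seq a) ?undup_uniq //= big1 => [|b /negPf ba].
    by rewrite addr0 -scalemxAr eigenproj_idem -scalemxAl.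
  by rewrite -scalemxAr eigenproj_orth ?scaler0 // eq_sym ba.
exists (q * p); rewrite !poly_mx_spectral !mulmx_suml.
apply: eq_big_seq => a a_in.
by rewrite hornerM -!scalemxAl uv // scalerA.
Qed.

End Spectral.

(** * Parallel columns of an orthogonal projection *)

Lemma adj_mul_eq0 (C : numClosedFieldType) m (x : 'cV[C]_m) :
  x ^t* *m x = 0 -> x = 0.
Proof.
move=> /matrixP/(_ 0 0); rewrite !mxE => xx; apply/colP => i; rewrite mxE.
have x2 (j : 'I_m) : x^t* 0 j * x j 0 = `|x j 0| ^+ 2 by rewrite !mxE normCKC.
have : \sum_j `|x j 0| ^+ 2 = 0 by rewrite -[RHS]xx; apply: eq_bigr => j _.
move/eqP; rewrite psumr_eq0 => [/allP/(_ i (mem_index_enum i))|j _]; last first.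
  by rewrite exprn_ge0.
by rewrite implyTb expf_eq0 normr_eq0 => /eqP.
Qed.

Section Projection.
Variables (C : numClosedFieldType) (m : nat) (E : 'M[C]_m).
Hypotheses (E_idem : E *m E = E) (E_adj : E ^t* = E).

Lemma proj_isotropic (w : 'cV[C]_m) : w ^t* *m (E *m w) = 0 -> E *m w = 0.
Proof.
move=> wEw; apply: adj_mul_eq0.
by rewrite trmx_mul map_mxM /= E_adj -mulmxA (mulmxA E) E_idem.
Qed.

(** The minor is the Gram determinant of [x := E e_u] and [y := E e_v], because
the entries of [E] are the inner products of its columns. *)
Lemma parallel_proj_minor2 u v :
  parallel_vec (E *m basis_cV C u) (E *m basis_cV C v) <-> minor2 E u v = 0.
Proof.
rewrite /minor2; split=> [[c []]|det0].
- rewrite -!colE => /colP E_uv.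
  have := E_uv u; have := E_uv v; rewrite !mxE => -> ->; ring.
- rewrite -!colE => /colP E_uv.
  have := E_uv u; have := E_uv v; rewrite !mxE => -> ->; ring.
have Ev0 : E v v = 0 -> E *m basis_cV C v = 0.
  move=> Evv; apply: proj_isotropic; apply/matrixP => i j.
  rewrite -colE mxE [RHS]mxE (bigD1 v) //= !mxE Evv mulr0.
  rewrite big1 ?addr0 // => k kv.
  by rewrite !mxE (negPf kv) conjC0 mul0r.
have [/Ev0 y0|Evv] := eqVneq (E v v) 0.
  by exists 0; right; rewrite y0 scale0r.
exists (E v u / E v v); left.
(* [w] is chosen so that [E w] vanishes at [u] and [v], hence is orthogonal to
   [w], which is supported there. *)
pose w := E v v *: basis_cV C u - E v u *: basis_cV C v.
have Ew i : (E *m w) i 0 = E v v * E i u - E v u * E i v.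
  by rewrite mulmxBr -!scalemxAr -!colE !mxE.
have Ew0 : E *m w = 0.
  apply: proj_isotropic; apply/matrixP => i j; rewrite !ord1 {i j} mxE [RHS]mxE.
  apply: big1 => i _; rewrite Ew.
  have [->|iu] := eqVneq i u.
    by rewrite mulrC [E v u * _]mulrC [E v v * _]mulrC det0 mul0r.
  have [->|iv] := eqVneq i v.
    by rewrite mulrC [E v u * _]mulrC subrr mul0r.
  by rewrite !mxE (negPf iu) (negPf iv) !mulr0 subrr conjC0 mul0r.
apply/colP => i; have /colP/(_ i) := Ew0; rewrite Ew -!colE !mxE => /eqP.
rewrite subr_eq0 => /eqP Ei; apply: (mulfI Evv).
by rewrite Ei mulrA mulrCA divff // mulr1.
Qed.

End Projection.

(** * Poles of the ratio of characteristic polynomials *)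

Section Poles.
Variables (C : numClosedFieldType) (m : nat) (H : 'M[C]_m).
Hypothesis H_normal : H \is normalmx.
Local Notation E := (eigenproj H).
Local Notation s := (spectrum H).

Definition spec_cofactor a : {poly C} := \prod_(b <- s | b != a) ('X - b%:P).
Definition spec_poly : {poly C} := \prod_(b <- s) ('X - b%:P).

(** The adjugate of [X - H] divided by [char_poly H / spec_poly]. *)
Definition reduced_adj : 'M[{poly C}]_m :=
  \sum_(a <- s) spec_cofactor a *: map_mx polyC (E a).

Lemma spec_polyE a : a \in s -> spec_poly = ('X - a%:P) * spec_cofactor a.
Proof. by move=> a_in; rewrite /spec_poly (bigD1_seq a) ?undup_uniq. Qed.

Lemma spec_cofactor_diag a : (spec_cofactor a).[a] != 0.
Proof.
rewrite horner_prod prodf_seq_neq0; apply/allP => b _; apply/implyP => ba.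
by rewrite !hornerE subr_eq0 eq_sym.
Qed.

Lemma spec_cofactor_off a b : a \in s -> a != b -> (spec_cofactor b).[a] = 0.
Proof.
move=> a_in ab; apply/eqP; rewrite horner_prod prodf_seq_eq0.
by apply/hasP; exists a => //; rewrite ab !hornerE subrr eqxx.
Qed.

Lemma char_mul_reduced_adj : char_poly_mx H *m reduced_adj = spec_poly%:M.
Proof.
have -> : spec_poly%:M = \sum_(a <- s) spec_poly *: map_mx polyC (E a).
  rewrite -scaler_sumr -(raddf_sum (map_mx polyC)) /= eigenproj_sum1 //.
  by rewrite map_mx1 scalemx1.
rewrite mulmx_sumr; apply: eq_big_seq => a a_in.
rewrite -scalemxAr /char_poly_mx mulmxBl -map_mxM eigenproj_eigen.
rewrite map_mxZ mul_scalar_mx -scalerBl scalerA mulrC.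
by rewrite (spec_polyE a_in).
Qed.

Lemma reduced_adj_at a i j : a \in s ->
  (reduced_adj i j).[a] = (spec_cofactor a).[a] * E a i j.
Proof.
move=> a_in; rewrite /reduced_adj summxE horner_sum.
rewrite (bigD1_seq a) ?undup_uniq //= big1 ?addr0 => [|b ba].
  by rewrite !mxE hornerM hornerC.
rewrite !mxE hornerM hornerC.
by rewrite spec_cofactor_off ?mul0r // eq_sym.
Qed.

(** This shows that [char_poly_del S H] is monic, hence nonzero. *)
Lemma char_poly_delE (S : {set 'I_m}) :
  char_poly_del S H = char_poly (mxsub enum_val enum_val H : 'M_#|~: S|).
Proof.
rewrite /char_poly_del /char_poly; congr (\det _); apply/matrixP => i j.
by rewrite !mxE (inj_eq enum_val_inj).
Qed.

(** Multiplicities at [a] in Jacobi's identity give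
[mup a phi + mup a minor = 2 + mup a phi_S], where [minor] is that of
[reduced_adj] on [u, v]; so the pole is at most simple iff [a] is a root of
this minor. *)
Lemma poles_simpleP u v : u != v ->
  poles_simple (tofrac (char_poly_del [set u; v]%SET H)
                   / tofrac (char_poly H)) <->
  forall a, a \in s -> minor2 (E a) u v = 0.
Proof.
move=> uv; set phiS := char_poly_del _ H; set phi := char_poly H.
have phi0 : phi != 0 by rewrite monic_neq0 ?char_poly_monic.
have phiS0 : phiS != 0.
  by rewrite /phiS char_poly_delE monic_neq0 ?char_poly_monic.
have psi0 : spec_poly != 0.
  by rewrite monic_neq0 // monic_prod_XsubC.
have jac : phi * minor2 reduced_adj u v = spec_poly ^+ 2 * phiS.
  exact: (jacobi_minor2 uv char_mul_reduced_adj).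
have D0 : minor2 reduced_adj u v != 0.
  have : phi * minor2 reduced_adj u v != 0.
    by rewrite jac mulf_neq0 // expf_neq0.
  by rewrite mulf_eq0 => /norP[].
have mup_psi2 a : a \in s -> mup a (spec_poly ^+ 2) = 2.
  move=> a_in; rewrite (spec_polyE a_in) exprMn mupMl ?mup_XsubCX ?eqxx //.
  by rewrite rootE horner_exp expf_neq0 // spec_cofactor_diag.
have rootD a : a \in s ->
    root (minor2 reduced_adj u v) a = (minor2 (E a) u v == 0).
  move=> a_in; rewrite rootE hornerD hornerN !hornerM !reduced_adj_at //.
  have -> (p w x y z : C) :
      p * w * (p * x) - p * y * (p * z) = p ^+ 2 * (w * x - y * z).
    by ring.
  by rewrite mulf_eq0 expf_eq0 (negPf (spec_cofactor_diag a)).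
have key a : a \in s ->
    (mup a phi <= (mup a phiS).+1)%N = (minor2 (E a) u v == 0).
  move=> a_in.
  have jac_mup :
      (mup a phi + mup a (minor2 reduced_adj u v) = 2 + mup a phiS)%N.
    by rewrite -mupM // jac mupM ?expf_neq0 // mup_psi2.
  rewrite -rootD // root_factor_theorem -['X - _]expr1 -mup_geq //.
  rewrite -(leq_add2r (mup a (minor2 reduced_adj u v))) jac_mup.
  by rewrite addnC -addSnnS leq_add2l.
split=> [simple a a_in|det0 a k /(pole_of_orderE _ _ phiS0 phi0) [k_gt0 mupE]].
  apply/eqP; rewrite -key // leqNgt; apply/negP => lt.
  have lt_mup := ltnW lt; have le_mup := ltnW lt_mup.
  have pole :
      pole_of_order (tofrac phiS / tofrac phi) a (mup a phi - mup a phiS).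
    by apply/(pole_of_orderE _ _ phiS0 phi0); rewrite subn_gt0 subnKC.
  have := subnKC le_mup; rewrite (simple _ _ pole) addn1 => E1.
  by rewrite E1 ltnn in lt.
apply/eqP; rewrite eqn_leq k_gt0 andbT.
have [a_in|] := boolP (a \in s).
  by have := key a a_in; rewrite det0 // eqxx mupE -addn1 leq_add2l => ->.
rewrite -(eigenvalue_spectrum H_normal) eigenvalue_root_char => /mupNroot.
by rewrite mupE; case: (k) => // k'; rewrite addnS.
Qed.

End Poles.

(** * Inclusion of cyclic modules *)

Lemma interpolation (F : fieldType) (s : seq F) (Q : F -> F -> Prop) :
    (forall a, a \in s -> exists c, Q a c) ->
  exists p : {poly F}, forall a, a \in s -> Q a p.[a].
Proof.
elim: s => [|a s IHs] Qs; first by exists 0.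
have [|p pQ] := IHs; first by move=> b bs; apply: Qs; rewrite inE bs orbT.
have [a_in|a_out] := boolP (a \in s).
  by exists p => b; rewrite inE => /predU1P[->|]; apply: pQ.
have [|c Qc] := Qs a; first exact: mem_head.
(* Correct [p] at [a] by a multiple of [z], which vanishes on [s]. *)
pose z : {poly F} := \prod_(b <- s) ('X - b%:P).
have rz b : root z b = (b \in s) by rewrite root_prod_XsubC.
have za : z.[a] != 0 by rewrite -rootE rz.
exists (p + ((c - p.[a]) / z.[a]) *: z) => b; rewrite inE hornerD hornerZ.
case/predU1P=> [->|b_in]; first by rewrite divfK // addrC subrK.
by have := rz b; rewrite b_in rootE => /eqP->; rewrite mulr0 addr0; apply: pQ.
Qed.

Section Modules.
Variables (C : numClosedFieldType) (m : nat) (H : 'M[C]_m) (u v : 'I_m).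
Hypothesis H_normal : H \is normalmx.
Local Notation Ee a u := (eigenproj H a *m basis_cV C u).

Lemma cyclic_module_subset_parallel :
  (cyclic_module H u `<=` cyclic_module H v)%classic <->
  forall a, eigenvalue H a ->
    exists c, Ee a u = c *: Ee a v.
Proof.
rewrite cyclic_module_subP //; split=> [[p uv] a|uv].
  by rewrite eigenvalue_spectrum // => a_in; exists p.[a]; apply: uv.
apply: (interpolation (Q := fun a c => Ee a u = c *: Ee a v)) => a.
by rewrite -eigenvalue_spectrum //; apply: uv.
Qed.

(** If parallelism makes [y] the multiple, the scalar can be inverted unless it
is zero; then [y = 0], and the condition forces [x = 0]. *)
Lemma parallel_vec_scale n (x y : 'cV[C]_n) :
  parallel_vec x y -> (y = 0 -> x = 0) -> exists c, x = c *: y.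
Proof.
case=> c [->|yE] y0x0; first by exists c.
have [c0|c0] := eqVneq c 0; last first.
  by exists c^-1; rewrite yE scalerA mulVf ?scale1r.
by exists 0; rewrite scale0r y0x0 // yE c0 scale0r.
Qed.

Lemma parallel_vec_sym n (x y : 'cV[C]_n) :
  parallel_vec x y -> parallel_vec y x.
Proof. by case=> c []->; exists c; [right | left]. Qed.

Lemma eig_support_subset :
  (forall a, eigenvalue H a -> Ee a v = 0 -> Ee a u = 0) <->
  (eig_support H u `<=` eig_support H v)%classic.
Proof.
split=> [uv a [Ha Eu]|uv a Ha Ev].
  by split=> // /(uv _ Ha).
have [//|/eqP Eu] := eqVneq (Ee a u) 0.
by have [_ /(_ Ev)] := uv a (conj Ha Eu).
Qed.
End Modules.

(** * Parallel columns, simple poles and equal modules *)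

Theorem theorem2p6 (R : realType) (m : nat) (H : 'M[R[i]]_m) (u v : 'I_m)
    (H_herm : H \is hermsymmx) (neq_uv : u <> v) :
  (parallel_cols H u v <->
     poles_simple (tofrac (char_poly_del [set u; v]%SET H)
                   / tofrac (char_poly H)))
  /\
  (parallel_cols H u v /\ eig_support H u = eig_support H v <->
     cyclic_module H u = cyclic_module H v).
Proof.
have H_normal := hermitian_normalmx H_herm; have /eqP uv := neq_uv.
have parE a :
    parallel_vec (eigenproj H a *m basis_cV _ u) (eigenproj H a *m basis_cV _ v)
    <-> minor2 (eigenproj H a) u v = 0.
  exact: parallel_proj_minor2 (eigenproj_idem H a) (eigenproj_adj H a) u v.
split.
  rewrite poles_simpleP //.
  by split=> par a; have := par a; rewrite parE eigenvalue_spectrum.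
rewrite !eqEsubset -!eig_support_subset !cyclic_module_subset_parallel //.
split=> [[par [uvS vuS]]|[uvM vuM]].
  split=> a Ha; apply: parallel_vec_scale; [exact: par | exact: uvS | | ].
    exact/parallel_vec_sym/par.
  exact: vuS.
split; first by move=> a /uvM[c Eu]; exists c; left.
split=> a Ha E0; [have [c ->] := uvM a Ha | have [c ->] := vuM a Ha].
all: by rewrite E0 scaler0.
Qed.
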